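(* Let $f:N\to\mathbb{R}^u\times\mathbb{R}^s$ be a $C^1$ function with $f(0)=0$, where $N=\overline{B}_u\times\overline{B}_s$. Let $\alpha_h,\alpha_v\in(0,1)$ and assume that $m_v>m_h>0$ and $m_h<1$. Let $r^s=\sqrt{1-\alpha_h}$ and $U=\overline{B}_u\times\overline{B}_s(0,r^s)$. If $f$ satisfies cone conditions for $(Q_h,m_h)$ and for $(Q_v,m_v)$ in $N$, then there exists a function $w^s:\overline{B}_s(0,r^s)\to B_u$ such that $$W^s_{\sqrt{m_h},N}\cap U=\{(w^s(y),y) : y\in\overline{B}_s(0,r^s)\}.$$ Moreover, $w^s$ is Lipschitz with constant $L_s=\sqrt{\alpha_v}$.
   Context: All norms are Euclidean. $B_k(x,r)$ is the open ball in $\mathbb{R}^k$ of radius $r$ centered at $x$, $B_k=B_k(0,1)$, and bars denote closures. $N=\overline{B}_u\times\overline{B}_s\subset\mathbb{R}^u\times\mathbb{R}^s$, with points written $(x,y)$, $x\in\mathbb{R}^u$, $y\in\mathbb{R}^s$. For $\alpha_h,\alpha_v\in(0,1)$ the functions $Q_h,Q_v:\mathbb{R}^u\times\mathbb{R}^s\to\mathbb{R}$ are $$Q_h(x,y)=\alpha_h\|x\|^2-\|y\|^2,\qquad Q_v(x,y)=\|x\|^2-\alpha_v\|y\|^2.$$ Cone conditions: for $\alpha,\beta,m>0$ and $Q(x,y)=\alpha\|x\|^2-\beta\|y\|^2$, $f$ satisfies cone conditions for $(Q,m)$ in $N$ if $Q(f(p_1)-f(p_2))>m\,Q(p_1-p_2)$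 for all $p_1,p_2\in N$ with $p_1\neq p_2$. Strong stable manifold: for a neighborhood $V$ of zero and $\lambda<1$, $W^s_{\lambda,V}\subset V$ is the set of all points $p\in V$ such that (1) $f^n(p)\in V$ for all $n\in\mathbb{N}$; and (2) there exists a constant $C>0$ (which can depend on $p$) such that $\|f^n(p)\|\le C\lambda^n$ for all $n\ge 0$. Here $V=N$ and $\lambda=\sqrt{m_h}$. *)

(* Defs.v *)
From HB Require Import structures.
From mathcomp Require Import all_boot all_order all_algebra.
From mathcomp Require Import all_classical all_reals all_analysis.
Set Implicit Arguments.
Unset Strict Implicit.
Unset Printing Implicit Defensive.
Import Order.TTheory GRing.Theory Num.Theory.
Import numFieldNormedType.Exports.
Local Open Scope classical_set_scope.
Local Open Scope ring_scope.

(* The library norm on ['rV_k] and on products is the sup norm; all metric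
   notions below use the Euclidean norm instead (same topology). *)
Definition enorm (R : realType) (k : nat) (x : 'rV[R]_k) : R :=
  Num.sqrt (\sum_(i < k) x ord0 i ^+ 2).

Definition enorm2 (R : realType) (u s : nat) (p : 'rV[R]_u * 'rV[R]_s) : R :=
  Num.sqrt (enorm p.1 ^+ 2 + enorm p.2 ^+ 2).

Definition eball (R : realType) (k : nat) (x : 'rV[R]_k) (r : R)
  : set 'rV[R]_k := [set z | enorm (z - x) < r].

Definition ecball (R : realType) (k : nat) (x : 'rV[R]_k) (r : R)
  : set 'rV[R]_k := [set z | enorm (z - x) <= r].

Definition quadQ (R : realType) (u s : nat) (alpha beta : R)
    (p : 'rV[R]_u * 'rV[R]_s) : R :=
  alpha * enorm p.1 ^+ 2 - beta * enorm p.2 ^+ 2.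

Definition cone_conditions (R : realType) (u s : nat)
    (N : set ('rV[R]_u * 'rV[R]_s))
    (f : 'rV[R]_u * 'rV[R]_s -> 'rV[R]_u * 'rV[R]_s)
    (Q : 'rV[R]_u * 'rV[R]_s -> R) (m : R) : Prop :=
  forall p1 p2, N p1 -> N p2 -> p1 <> p2 ->
    Q (f p1 - f p2) > m * Q (p1 - p2).

(* [f] is C^1 on a set [A] that need not be open: at each point of [A] it is
   Frechet differentiable relative to [A], and the derivative is continuous on
   [A] (stated vectorwise, which in finite dimension is the same as in operator
   norm).  Only the values of [f] on [A] matter. *)
Definition C1_on (R : realType) (V W : normedModType R) (A : set V)
    (f : V -> W) : Prop :=
  exists Df : V -> {linear V -> W},
    (forall p, A p ->
       (fun q => f q - f p - Df p (q - p)) =o_ (within A (nbhs p))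
       (fun q => q - p)) /\
    (forall v : V, {within A, continuous (fun p => Df p v)}).

(* If only the restriction of [f] to [V] is meaningful, [iter n f p] is the n-th
   iterate of that restriction as long as the orbit stays in [V], which the
   first condition ensures. *)
Definition strong_stable (R : realType) (u s : nat)
    (f : 'rV[R]_u * 'rV[R]_s -> 'rV[R]_u * 'rV[R]_s) (lambda : R)
    (V : set ('rV[R]_u * 'rV[R]_s)) : set ('rV[R]_u * 'rV[R]_s) :=
  [set p | V p /\ (forall n : nat, V (iter n f p)) /\
     exists2 C : R, 0 < C &
       forall n : nat, enorm2 (iter n f p) <= C * lambda ^+ n].

(* Main.v *)
Require Import Defs.
From HB Require Import structures.
From mathcomp Require Import all_boot all_order all_algebra.
From mathcomp Require Import all_classical all_reals all_analysis.
From mathcomp Require Import ring lra.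
Import Order.TTheory GRing.Theory Num.Theory.
Import numFieldNormedType.Exports.
Set Implicit Arguments.
Unset Strict Implicit.
Unset Printing Implicit Defensive.
Local Open Scope classical_set_scope.
Local Open Scope ring_scope.

(** Write [Q_h] for [quadQ alpha_h 1] and [Q_v] for [quadQ 1 alpha_v].

Uniqueness and the Lipschitz bound come from the vertical cone.  If two
distinct orbits decay at rate [Num.sqrt m_h] and their difference had [Q_v >= 0], then
[Q_v] of the difference would become positive after one step and afterwards
grow at least like [m_v ^+ n], while it is at most a constant times
[m_h ^+ n]; this is impossible because [m_h < m_v]
([quadQ_strong_stable_lt0]).  So distinct points of the stable set satisfy
[`|x1 - x2|^2 < alpha_v * `|y1 - y2|^2], which makes the stable set a Lipschitz
graph over its projection to the [y] axis.

Existence needs, over each [y], a point whose whole orbit stays in [N] and in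
the set [Q_v <= 0].  Along such an orbit [Q_h] is at least [m_h ^+ n] times its
initial value, while [Q_v <= 0] makes [- Q_h] comparable with the squared norm,
so the orbit decays at the required rate ([forward_cone_strong_stable]).  By
compactness it is enough to find, for each [n], a point over [y] satisfying
these constraints up to time [n] ([forward_cone_orbit_exists]), and since
[Q_v <= 0] is inherited by preimages in [N], it is enough that the orbit stays
in [N] and that the [n]-th iterate lies on the [y] axis ([returns_to_axis]).

That point is obtained by continuation along the segment from [0] to [y],
starting from the fixed point.  The set of solutions is compact, so only local
continuation is at stake.  The two cones and the radius
[Num.sqrt (1 - alpha_h)] keep the orbit of a solution in the interior of [N]
([orbit_interior]), where all iterates are differentiable.  The horizontal cone
makes [x |-> (f^n (x, y)).1] expanding up to the constant
[Num.sqrt m_h ^+ n] ([fst_iter_expanding]), whatever the size of [m_h], and an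
expanding differentiable map which is small at the centre of a ball has a zero
in that ball ([expanding_zero]).  The last fact replaces both the implicit
function theorem and degree theory: at a minimum of the norm of the map the
derivative is invertible, so the norm could be decreased unless it vanishes. *)

(** * The Euclidean norm *)

Lemma enorm_ge0 (R : realType) k (x : 'rV[R]_k) : 0 <= enorm x.
Proof. exact: sqrtr_ge0. Qed.

Lemma sqr_enorm (R : realType) k (x : 'rV[R]_k) :
  enorm x ^+ 2 = \sum_(i < k) x ord0 i ^+ 2.
Proof. by rewrite sqr_sqrtr// sumr_ge0// => i _; exact: sqr_ge0. Qed.

Lemma enormZ (R : realType) k (a : R) (x : 'rV[R]_k) :
  enorm (a *: x) = `|a| * enorm x.
Proof.
rewrite /enorm -sqrtr_sqr -sqrtrM ?sqr_ge0// mulr_sumr; congr Num.sqrt.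
by apply: eq_bigr => i _; rewrite mxE exprMn.
Qed.

Lemma enorm0 (R : realType) k : enorm (0 : 'rV[R]_k) = 0.
Proof. by rewrite -(scale0r 0) enormZ normr0 mul0r. Qed.

Lemma enormN (R : realType) k (x : 'rV[R]_k) : enorm (- x) = enorm x.
Proof. by rewrite -scaleN1r enormZ normrN1 mul1r. Qed.

Lemma enorm_eq0 (R : realType) k (x : 'rV[R]_k) : enorm x = 0 -> x = 0.
Proof.
move=> x0; apply/rowP => i; rewrite mxE; apply/eqP.
have := sqr_enorm x; rewrite x0 expr0n => /esym/eqP.
rewrite psumr_eq0 => [/allP/(_ i)|j _]; last exact: sqr_ge0.
by rewrite mem_index_enum sqrf_eq0; exact.
Qed.

(** Cauchy-Schwarz, by summing
[2 a b x_i y_i <= b^2 x_i^2 + a^2 y_i^2] with [a] and [b] the two norms. *)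
Lemma le_dot_enorm (R : realType) k (x y : 'rV[R]_k) :
  \sum_(i < k) x ord0 i * y ord0 i <= enorm x * enorm y.
Proof.
have [/eqP|a0] := eqVneq (enorm x) 0.
  move=> /eqP a0; rewrite a0 mul0r (enorm_eq0 a0) big1// => i _.
  by rewrite mxE mul0r.
have [b0|b0] := eqVneq (enorm y) 0.
  by rewrite b0 mulr0 (enorm_eq0 b0) big1// => i _; rewrite mxE mulr0.
have ab : 0 < enorm x * enorm y by rewrite mulr_gt0// lt_def enorm_ge0 andbT.
rewrite -(ler_pM2l ab) -(@ler_pM2l _ 2)// mulr_sumr mulr_sumr.
apply: (@le_trans _ _ (\sum_(i < k) (enorm y ^+ 2 * x ord0 i ^+ 2
    + enorm x ^+ 2 * y ord0 i ^+ 2))).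
  apply: ler_sum => i _.
  have := sqr_ge0 (enorm y * x ord0 i - enorm x * y ord0 i).
  by rewrite -subr_ge0 => h; rewrite -subr_ge0; apply: le_trans h _; lra.
by rewrite big_split/= -!mulr_sumr -!sqr_enorm; lra.
Qed.

Lemma enormD (R : realType) k (x y : 'rV[R]_k) :
  enorm (x + y) <= enorm x + enorm y.
Proof.
rewrite -(@ler_pXn2r _ 2)// ?nnegrE ?addr_ge0 ?enorm_ge0// sqr_enorm.
have -> : \sum_(i < k) (x + y) ord0 i ^+ 2 =
    enorm x ^+ 2 + enorm y ^+ 2 + 2 * \sum_(i < k) x ord0 i * y ord0 i.
  rewrite !sqr_enorm mulr_sumr -!big_split/=.
  by apply: eq_bigr => i _; rewrite mxE; ring.
by have := le_dot_enorm x y; lra.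
Qed.

(** The comparison with the sup norm through which Euclidean balls become
compact and shrink to neighbourhoods. *)
Lemma ler_norm_enorm (R : realType) k (x : 'rV[R]_k) : `|x| <= enorm x.
Proof.
rewrite (_ : `|x| = mx_norm x)// mx_normrE; apply/bigmax_leP; split=> [|[i j] _ /=].
  exact: enorm_ge0.
rewrite ord1 -[leLHS]sqrtr_sqr ler_wsqrtr// (bigD1 j)//= lerDl.
by rewrite sumr_ge0// => l _; exact: sqr_ge0.
Qed.

Lemma enorm_continuous (R : realType) k :
  continuous (@enorm R k : 'rV[R]_k -> R).
Proof.
move=> x; apply: (@continuous_comp _ _ _
  (fun z : 'rV[R]_k => \sum_(i < k) z ord0 i ^+ 2) Num.sqrt); last first.
  exact: sqrt_continuous.
move: x; apply: (@continuous_big R 'I_k +%R 0) => [|i _ x].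
  exact: add_continuous.
exact: (continuous_comp (@coord_continuous R _ _ ord0 i x) (@exprn_continuous R 2 _)).
Qed.

Lemma edist_continuous (R : realType) k (x : 'rV[R]_k) :
  continuous (fun z : 'rV[R]_k => enorm (z - x)).
Proof.
move=> z.
have zx : {for z, continuous (fun z : 'rV[R]_k => z - x)}.
  exact: (cvgB cvg_id (cvg_cst x)).
exact: (continuous_comp zx (@enorm_continuous R k _)).
Qed.

Lemma closed_ecball (R : realType) k (x : 'rV[R]_k) r : closed (ecball x r).
Proof.
have /continuous_closedP h := @edist_continuous R k x.
exact: h _ (@closed_le _ r).
Qed.

Lemma open_eball (R : realType) k (x : 'rV[R]_k) r : open (eball x r).
Proof.
have /continuousP h := @edist_continuous R k x.
exact: h _ (@open_lt _ r).
Qed.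

Lemma compact_ecball (R : realType) k (x : 'rV[R]_k) r : compact (ecball x r).
Proof.
apply: bounded_closed_compact; last exact: closed_ecball.
exists (r + `|x|); split=> [|M rM z zx]; first exact: num_real.
apply: le_trans (ltW rM); rewrite -[z](subrK x); apply: le_trans (ler_normD _ _) _.
by rewrite lerD2r (le_trans (ler_norm_enorm _)).
Qed.

Lemma nbhs_ecball (R : realType) k (x : 'rV[R]_k) (A : set 'rV[R]_k) :
  nbhs x A -> exists2 e, 0 < e & ecball x e `<=` A.
Proof.
move=> /nbhs_closedballP[r rA]; exists r%:num => // z xz; apply: rA.
rewrite closed_ballE//= /closed_ball_ /= -normrN opprB.
exact: le_trans (ler_norm_enorm _) xz.
Qed.

(** * Zeros of expanding differentiable maps *)

Lemma near_line (R : realType) (V : normedModType R) (x v : V) (A : set V) :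
  nbhs x A -> \forall h \near (0 : R), A (h *: v + x).
Proof.
move=> xA; have : (fun h : R => h *: v + x) @ (0 : R) --> (0 *: v + x).
  by apply: cvgD; [apply: cvgZr_tmp; exact: cvg_id|exact: cvg_cst].
by rewrite scale0r add0r; apply.
Qed.

(** Difference quotients inherit the lower bound, hence so does their limit. *)
Lemma enorm_derive_ge (R : realType) k l (F : 'rV[R]_k -> 'rV[R]_l) x v c :
  differentiable F x ->
  (\forall z \near x, c * enorm (z - x) <= enorm (F z - F x)) ->
  c * enorm v <= enorm ('D_v F x).
Proof.
move=> dF Fc; have dv := @diff_derivable _ _ _ _ _ v dF.
have lim_e : enorm (h^-1 *: ((F \o shift x) (h *: v) - F x)) @[h --> 0^']
    --> enorm ('D_v F x).
  by apply: (continuous_cvg _ (@enorm_continuous R l _)).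
have line := near_line v Fc.
apply: (cvgr_to_ge lim_e); near=> h.
have h0 : h != 0 by near: h; exact: nbhs_dnbhs_neq.
have hx : 0 < `|h^-1| by rewrite normr_gt0 invr_eq0.
rewrite enormZ -ler_pdivrMl// normfV invrK mulrCA -enormZ.
have : c * enorm (h *: v + x - x) <= enorm (F (h *: v + x) - F x).
  by near: h; exact: nbhs_dnbhs line.
by rewrite addrK.
Unshelve. all: by end_near. Qed.

(** A point [x] of the ball where the norm of [F] is least cannot lie on the
sphere, since [F] is expanding and too small at the centre.  The derivative at
[x] is injective by [enorm_derive_ge], hence onto, so in some direction [v] it
equals [- F x]; moving slightly along [v] would shrink [F] unless
[F x = 0]. *)
Lemma expanding_zero (R : realType) k (F : 'rV[R]_k -> 'rV[R]_k) x0 e c :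
  0 < c -> 0 < e ->
  (forall x1 x2, ecball x0 e x1 -> ecball x0 e x2 ->
     c * enorm (x1 - x2) <= enorm (F x1 - F x2)) ->
  (forall x, ecball x0 e x -> differentiable F x) ->
  enorm (F x0) < c * e / 2 ->
  exists2 x, ecball x0 e x & F x = 0.
Proof.
move=> c0 e0 Fexp Fdiff Fx0.
have x0B : ecball x0 e x0 by rewrite /ecball/= subrr enorm0 ltW.
have Fcont : {within ecball x0 e, continuous (fun x => enorm (F x))}.
  apply: continuous_in_subspaceT => x /set_mem xB.
  apply: continuous_comp; last exact: enorm_continuous.
  exact/differentiable_continuous/Fdiff.
have [|x /set_mem xB xmin] := compact_EVT_min _ (@compact_ecball R k x0 e) Fcont.
  by exists x0.
exists x => //; apply: contrapT => /eqP Fx_neq0.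
have xx0 : enorm (F x) <= enorm (F x0) by apply: xmin; exact: mem_set.
have xint : nbhs x (ecball x0 e).
  have xe : eball x0 e x.
    have h := Fexp x x0 xB x0B; have := enormD (F x) (- F x0).
    rewrite enormN => h'; rewrite /eball/= -(ltr_pM2l c0); lra.
  apply: filterS (open_nbhs_nbhs (conj (@open_eball R k x0 e) xe)) => z.
  exact: ltW.
have dF := Fdiff x xB.
have Dge v : c * enorm v <= enorm ('D_v F x).
  apply: enorm_derive_ge dF _; apply: filterS xint => z zB; exact: Fexp.
have Jfree : row_free ('J F x).
  apply: inj_row_free => v; rewrite -deriveEjacobian// => Dv0.
  apply: enorm_eq0; apply/eqP; rewrite eq_le enorm_ge0 andbT.
  by have := Dge v; rewrite Dv0 enorm0 pmulr_rle0.
have [v Dv] : exists v, 'D_v F x = - F x.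
  exists (- F x *m invmx ('J F x)); rewrite deriveEjacobian// mulmxKV//.
  by rewrite -row_free_unit.
have dv := @diff_derivable _ _ _ _ _ v dF.
(* Along [v] the difference quotients of [F] tend to [- F x]. *)
have lim_e : enorm (h^-1 *: ((F \o shift x) (h *: v) - F x) + F x) @[h --> 0^']
    --> enorm ('D_v F x + F x).
  apply: (continuous_cvg _ (@enorm_continuous R k _)).
  by apply: cvgD => //; exact: cvg_cst.
rewrite Dv addNr enorm0 in lim_e.
have Fx_gt0 : 0 < enorm (F x).
  rewrite lt_def enorm_ge0 andbT; apply: contra Fx_neq0 => /eqP/enorm_eq0 ->.
  by [].
have small := cvgr_lt (FF := at_right_proper_filter 0) _ (cvg_dnbhs_at_right lim_e) _ Fx_gt0.
have line : \forall h \near (0 : R)^'+, ecball x0 e (h *: v + x).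
  exact: (cvg_within _ (near_line v xint)).
have [h [h0 h1 hB hsmall]] : exists h : R, [/\ 0 < h, h < 1,
   ecball x0 e (h *: v + x) &
   enorm (h^-1 *: ((F \o shift x) (h *: v) - F x) + F x) < enorm (F x)].
  have : \forall h \near (0 : R)^'+, [/\ 0 < h, h < 1, ecball x0 e (h *: v + x) &
     enorm (h^-1 *: ((F \o shift x) (h *: v) - F x) + F x) < enorm (F x)].
    near=> h; split.
    - by near: h; exact: nbhs_right_gt.
    - by near: h; exact: nbhs_right_lt.
    - by near: h; exact: line.
    - by near: h; exact: small.
  by move=> /filter_ex.
have : enorm (F (h *: v + x)) < enorm (F x).
  (* The first term has norm [(1 - h) * enorm (F x)], the second is smaller
     than [h * enorm (F x)]. *)
  have -> : F (h *: v + x) = (1 - h) *: F x +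
      h *: (h^-1 *: ((F \o shift x) (h *: v) - F x) + F x).
    rewrite /=; move: (F (h *: v + x)) (F x) => /= y z.
    rewrite scalerDr scalerA divff ?gt_eqF// scale1r scalerBl scale1r.
    by rewrite [_ + h *: z]addrC subrKA addrC subrK.
  apply: le_lt_trans (enormD _ _) _; rewrite !enormZ !gtr0_norm ?subr_gt0//.
  rewrite -ltrBrDl; apply: lt_le_trans (_ : h * enorm (F x) <= _); last by lra.
  by rewrite ltr_pM2l.
by rewrite ltNge xmin//; exact: mem_set.
Unshelve. all: by end_near. Qed.

(** * Regularity of C1 maps on arbitrary sets *)

(** [C1_on] supplies bare linear maps; their continuity is due to the finite
dimension of the source. *)
Lemma linear_rV2_continuous (R : realType) u s (W : normedModType R)
  (L : {linear ('rV[R]_u * 'rV[R]_s)%type -> W}) : continuous L.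
Proof.
have -> : (L : _ -> W) = (fun p =>
    \sum_(i < u) p.1 ord0 i *: L (delta_mx ord0 i, 0) +
    \sum_(j < s) p.2 ord0 j *: L (0, delta_mx ord0 j)).
  apply/funext => -[x y] /=.
  have -> : (x, y) = \sum_(i < u) x ord0 i *: (delta_mx ord0 i, 0) +
      \sum_(j < s) y ord0 j *: (0, delta_mx ord0 j).
    apply: injective_projections => /=.
      rewrite !(big_morph fst (id1 := 0) (op1 := +%R)) //=.
      by rewrite [in LHS](row_sum_delta x) [X in _ + X]big1 ?addr0// => i _;
        rewrite scaler0.
    rewrite !(big_morph snd (id1 := 0) (op1 := +%R)) //=.
    by rewrite [in LHS](row_sum_delta y) [X in X + _]big1 ?add0r// => i _;
      rewrite scaler0.
  by rewrite linearD !linear_sum; congr (_ + _); apply: eq_bigr => i _;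
    rewrite linearZ.
move=> p; apply: cvgD.
  apply: (@continuous_big W 'I_u +%R 0 predT) => [|i _ {}p].
    exact: add_continuous.
  have c : {for p, continuous (fun q : 'rV[R]_u * 'rV[R]_s => q.1 ord0 i)}.
    apply: (@continuous_comp _ _ _ fst (fun z : 'rV[R]_u => z ord0 i)).
      exact: cvg_fst.
    exact: coord_continuous.
  exact: (cvgZr_tmp c).
apply: (@continuous_big W 'I_s +%R 0 predT) => [|i _ {}p].
  exact: add_continuous.
have c : {for p, continuous (fun q : 'rV[R]_u * 'rV[R]_s => q.2 ord0 i)}.
    apply: (@continuous_comp _ _ _ snd (fun z : 'rV[R]_s => z ord0 i)).
      exact: cvg_snd.
    exact: coord_continuous.
  exact: (cvgZr_tmp c).
Qed.

Lemma C1_on_cvg_within (R : realType) u s (W : normedModType R)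
    (A : set ('rV[R]_u * 'rV[R]_s)) (f : 'rV[R]_u * 'rV[R]_s -> W) p :
  C1_on A f -> A p -> f q @[q --> within A (nbhs p)] --> f p.
Proof.
move=> [Df [fDf _]] Ap; have /eqoP fo := fDf p Ap.
have Dcvg : Df p (q - p) @[q --> within A (nbhs p)] --> (0 : W).
  have qp : q - p @[q --> p] --> p - p by exact: (cvgB cvg_id (cvg_cst p)).
  have := continuous_cvg _ (@linear_rV2_continuous R u s W (Df p) _) qp.
  by rewrite subrr linear0 => Dqp B /Dqp; exact: (@cvg_within _ (nbhs p) _ A).
have ocvg : f q - f p - Df p (q - p) @[q --> within A (nbhs p)] --> (0 : W).
  apply/cvgr0Pnorm_le => e e0.
  have dist1 : \forall q \near within A (nbhs p), `|q - p| <= 1.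
    apply: (@cvg_within _ (nbhs p) _ A); near=> q; rewrite distrC.
    by near: q; apply: (@cvgr_dist_le _ _ _ (nbhs p) _ id p) => //; exact: cvg_id.
  have near1 := fo _ e0.
  near=> q; apply: (@le_trans _ _ (e * `|q - p|)); first by near: q.
  by rewrite -[leRHS]mulr1 ler_wpM2l ?(ltW e0)//; near: q.
have FF : Filter (within A (nbhs p)) by exact: within_filter.
have : f q - f p - Df p (q - p) + Df p (q - p) + f p
    @[q --> within A (nbhs p)] --> 0 + 0 + f p.
  by apply: cvgD; [exact: cvgD|exact: cvg_cst].
by rewrite !add0r; under [X in X @ _]eq_fun do rewrite !subrK.
Unshelve. all: by end_near. Qed.

Lemma C1_on_differentiable (R : realType) u s (W : normedModType R)
    (A : set ('rV[R]_u * 'rV[R]_s)) (f : 'rV[R]_u * 'rV[R]_s -> W) p :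
  C1_on A f -> nbhs p A -> differentiable f p.
Proof.
move=> [Df [fDf _]] Ap; have /eqoP fo := fDf p (nbhs_singleton Ap).
have Dc := @linear_rV2_continuous R u s W (Df p).
have fp : f \o shift p = cst (f p) + Df p +o_ 0 id.
  apply/eqaddoP => e /fo; rewrite /= within_interior// => fe.
  have : \forall q \near p, `|f q - f p - Df p (q - p)| <= e * `|q - p| by [].
  rewrite (near_shift (0 : 'rV[R]_u * 'rV[R]_s) p)/= subr0; apply: filterS => h /=.
  by rewrite addrK opprD addrA.
have dE := diff_unique Dc fp.
by apply/diff_locallyP; rewrite dE.
Qed.

(** * Orbits and limits *)

Lemma closed_setX (T U : topologicalType) (A : set T) (B : set U) :
  closed A -> closed B -> closed (A `*` B).
Proof.
have /continuous_closedP fstP : continuous (@fst T U) by move=> q; exact: cvg_fst.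
have /continuous_closedP sndP : continuous (@snd T U) by move=> q; exact: cvg_snd.
move=> Acl Bcl; exact: closedI (fstP _ Acl) (sndP _ Bcl).
Qed.

Lemma open_setX (T U : topologicalType) (A : set T) (B : set U) :
  open A -> open B -> open (A `*` B).
Proof.
have /continuousP fstP : continuous (@fst T U) by move=> q; exact: cvg_fst.
have /continuousP sndP : continuous (@snd T U) by move=> q; exact: cvg_snd.
move=> Aop Bop; exact: openI (fstP _ Aop) (sndP _ Bop).
Qed.

(** Iterates of a map known to be continuous only relative to [A] pass to the
limit along orbits that remain in [A]: closedness of [A] keeps each limit in
[A], where relative continuity can be used once more. *)
Lemma iter_cvg_within (T : topologicalType) (A : set T) (f : T -> T)
    (F : set_system T) (p : T) n :
  ProperFilter F -> closed A ->
  (forall q, A q -> f z @[z --> within A (nbhs q)] --> f q) ->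
  F --> p -> (forall k, (k <= n)%N -> \forall q \near F, A (iter k f q)) ->
  forall k, (k <= n)%N -> A (iter k f p) /\ iter k f q @[q --> F] --> iter k f p.
Proof.
move=> FF Acl fA Fp An; elim=> [|k IHk] kn.
  by split=> //; apply: closed_cvg Acl (An 0%N kn) _ Fp.
have [Ak fk] := IHk (ltnW kn).
have fkA : iter k f q @[q --> F] --> within A (nbhs (iter k f p)).
  by move=> B /fk; apply: filterS2 (An k (ltnW kn)) => q Aq; exact.
have fSk : iter k.+1 f q @[q --> F] --> iter k.+1 f p.
  by apply: cvg_trans (fA _ Ak) => B /fkA.
by split=> //; apply: closed_cvg Acl (An _ kn) _ fSk.
Qed.

(** The iterates of [f] need not be continuous off [A], so this is not a mere
preimage of a closed set; it is [iter_cvg_within] for points of the set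
converging to a point of its closure. *)
Lemma closed_orbits (T : topologicalType) (A C : set T) (f : T -> T) n :
  closed A -> closed C ->
  (forall q, A q -> f z @[z --> within A (nbhs q)] --> f q) ->
  closed [set p | (forall k, (k <= n)%N -> A (iter k f p)) /\ C (iter n f p)].
Proof.
move=> Acl Ccl fA p; set S := (X in closure X) => Sp.
have FF : ProperFilter (within S (nbhs p)) by exact: within_nbhs_proper.
have SF : \forall q \near within S (nbhs p), S q by exact: withinT.
have lim := @iter_cvg_within T A f (within S (nbhs p)) p n FF Acl fA.
have {}lim := lim (cvg_within _) _.
have {}lim k : (k <= n)%N -> A (iter k f p) /\
    iter k f q @[q --> within S (nbhs p)] --> iter k f p.
  by apply: lim => j jn; apply: filterS SF => q [+ _]; exact.
split=> [k /lim[]//|]; apply: closed_cvg Ccl _ _ (lim n (leqnn n)).2.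
by apply: filterS SF => q [].
Qed.

Lemma differentiable_iter (R : realType) (V : normedModType R) (f : V -> V)
    (O : set V) p n :
  (forall q, O q -> differentiable f q) ->
  (forall k, (k < n)%N -> O (iter k f p)) -> differentiable (iter n f) p.
Proof.
move=> fO; elim: n => [_|n IHn On]; first exact: (@ex_diff _ _ _ _ _ _ _ (is_diff_id p)).
apply: (@differentiable_comp _ _ _ _ (iter n f) f).
  by apply: IHn => k kn; apply: On; exact: ltnW.
by apply: fO; exact: On.
Qed.

Lemma near_orbit (R : realType) (V : normedModType R) (f : V -> V)
    (O : set V) p n :
  open O -> (forall q, O q -> differentiable f q) ->
  (forall k, (k <= n)%N -> O (iter k f p)) ->
  \forall q \near p, forall k, (k <= n)%N -> O (iter k f q).
Proof.
move=> Oop fO On.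
have near_k k : (k <= n)%N -> \forall q \near p, O (iter k f q).
  move=> kn; have /differentiable_continuous fk : differentiable (iter k f) p.
    by apply: differentiable_iter fO _ => j jk; apply: On; rewrite ltnW// (leq_trans jk).
  by apply: fk; apply: open_nbhs_nbhs; split=> //; exact: On.
elim: n {On} near_k => [|n IHn] near_k.
  by apply: filterS (near_k 0%N (leqnn _)) => q Oq k; rewrite leqn0 => /eqP ->.
have /IHn : forall k, (k <= n)%N -> \forall q \near p, O (iter k f q).
  by move=> k kn; apply: near_k; exact: leqW.
apply: filterS2 (near_k _ (leqnn _)) => q OSn On k.
by rewrite leq_eqVlt => /orP[/eqP ->//|]; rewrite ltnS; exact: On.
Qed.

(** * Cone conditions along orbits *)

Lemma cone_conditions_le (R : realType) u s (A : set ('rV[R]_u * 'rV[R]_s))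
    f a b m p1 p2 :
  cone_conditions A f (quadQ a b) m -> A p1 -> A p2 ->
  m * quadQ a b (p1 - p2) <= quadQ a b (f p1 - f p2).
Proof.
move=> fA A1 A2; have [->|/eqP p12] := eqVneq p1 p2.
  by rewrite !subrr /quadQ /= !enorm0 expr0n !mulr0 subrr mulr0.
exact/ltW/fA.
Qed.

Lemma cone_conditions_iter (R : realType) u s (A : set ('rV[R]_u * 'rV[R]_s))
    f a b m n p1 p2 :
  0 <= m -> cone_conditions A f (quadQ a b) m ->
  (forall k, (k < n)%N -> A (iter k f p1)) ->
  (forall k, (k < n)%N -> A (iter k f p2)) ->
  m ^+ n * quadQ a b (p1 - p2) <= quadQ a b (iter n f p1 - iter n f p2).
Proof.
move=> m0 fA; elim: n => [|n IHn] A1 A2; first by rewrite mul1r.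
rewrite exprS -mulrA; apply: le_trans (cone_conditions_le fA (A1 n _) (A2 n _)) => //.
by apply: ler_wpM2l => //; apply: IHn => k kn; [apply: A1|apply: A2]; exact: ltnW.
Qed.

Lemma enorm_fst_le (R : realType) u s (p : 'rV[R]_u * 'rV[R]_s) :
  enorm p.1 <= enorm2 p.
Proof.
rewrite /enorm2 -[leLHS]ger0_norm ?enorm_ge0// -sqrtr_sqr ler_wsqrtr//.
by rewrite lerDl sqr_ge0.
Qed.

(** If the form were nonnegative on [p1 - p2], the cone condition would make it
positive after one step and then growing like [mv ^+ n], whereas it is bounded
by the squared norm of the difference, which is of order [m ^+ n]. *)
Lemma quadQ_strong_stable_lt0 (R : realType) u s
    (A : set ('rV[R]_u * 'rV[R]_s)) f a m mv p1 p2 :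
  0 < a -> 0 < m < mv -> cone_conditions A f (quadQ 1 a) mv ->
  strong_stable f (Num.sqrt m) A p1 -> strong_stable f (Num.sqrt m) A p2 ->
  p1 <> p2 -> quadQ 1 a (p1 - p2) < 0.
Proof.
move=> a0 /andP[m0 mmv] fA [_ [A1 [C1 C1_gt0 le1]]] [_ [A2 [C2 C2_gt0 le2]]] p12.
have mv0 : 0 < mv by exact: lt_trans mmv.
rewrite ltNge; apply/negP => Q_ge0.
set c := quadQ 1 a (f p1 - f p2).
have c0 : 0 < c.
  apply: le_lt_trans (fA p1 p2 (A1 0%N) (A2 0%N) p12).
  by rewrite mulr_ge0// ltW.
(* The comparison starts after the first step, because only there is the form
   known to be strictly positive. *)
have growth n : c <= (C1 + C2) ^+ 2 * m * (m / mv) ^+ n.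
  have lower : mv ^+ n * c <= quadQ 1 a (iter n.+1 f p1 - iter n.+1 f p2).
    rewrite !iterSr; apply: (cone_conditions_iter _ fA) => [|k _|k _].
    - exact: ltW.
    - by rewrite -iterSr; exact: A1.
    - by rewrite -iterSr; exact: A2.
  have upper : quadQ 1 a (iter n.+1 f p1 - iter n.+1 f p2)
      <= ((C1 + C2) * Num.sqrt m ^+ n.+1) ^+ 2.
    apply: (@le_trans _ _ (enorm (iter n.+1 f p1 - iter n.+1 f p2).1 ^+ 2)).
      by rewrite /quadQ mul1r gerBl mulr_ge0 ?sqr_ge0// ltW.
    rewrite ler_pXn2r ?nnegrE ?enorm_ge0//; last first.
      by rewrite mulr_ge0 ?exprn_ge0 ?sqrtr_ge0// addr_ge0// ltW.
    apply: le_trans (enormD _ _) _; rewrite enormN mulrDl.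
    by apply: lerD; apply: le_trans (enorm_fst_le _) _; [exact: le1|exact: le2].
  rewrite expr_div_n mulrA ler_pdivlMr ?exprn_gt0// mulrC.
  apply: le_trans (le_trans lower upper) _.
  by rewrite exprMn -exprM mulnC exprM sqr_sqrtr ?(ltW m0)// (exprS m) mulrA.
have r_lt1 : `|m / mv| < 1.
  by rewrite gtr0_norm ?divr_gt0// ltr_pdivrMr// mul1r.
have lim : (C1 + C2) ^+ 2 * m * (m / mv) ^+ n @[n --> \oo] --> (0 : R).
  rewrite -[X in _ --> X](mulr0 ((C1 + C2) ^+ 2 * m)).
  by apply: (cvgM (cvg_cst _)); exact: cvg_expr.
have : \forall n \near \oo, (C1 + C2) ^+ 2 * m * (m / mv) ^+ n < c.
  exact: cvgr_lt lim _ c0.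
by move=> /filter_ex[n]; apply/negP; rewrite -leNgt; exact: growth.
Qed.

(** * Orbits in the vertical cone *)

Section StableFibres.
Variables (R : realType) (u s : nat).
Variable f : 'rV[R]_u * 'rV[R]_s -> 'rV[R]_u * 'rV[R]_s.
Variables alpha_h alpha_v m_h m_v : R.

Let N := ecball (0 : 'rV[R]_u) 1 `*` ecball (0 : 'rV[R]_s) 1.
Let Nint := eball (0 : 'rV[R]_u) 1 `*` eball (0 : 'rV[R]_s) 1.
Let r_s := Num.sqrt (1 - alpha_h).

Hypothesis f_C1 : C1_on N f.
Hypothesis f0 : f 0 = 0.
Hypotheses (alpha_h_bounds : 0 < alpha_h < 1) (alpha_v_bounds : 0 < alpha_v < 1).
Hypotheses (m_h_bounds : 0 < m_h < 1) (m_v_gt0 : 0 < m_v).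
Hypothesis cone_h : cone_conditions N f (quadQ alpha_h 1) m_h.
Hypothesis cone_v : cone_conditions N f (quadQ 1 alpha_v) m_v.

Let iter_f0 n : iter n f 0 = 0.
Proof. by elim: n => //= n ->. Qed.

Let N0 : N 0.
Proof. by split; rewrite /ecball/= subr0 enorm0 ler01. Qed.

Let closed_N : closed N.
Proof. by apply: closed_setX; exact: closed_ecball. Qed.

Let open_Nint : open Nint.
Proof. by apply: open_setX; exact: open_eball. Qed.

Let sub_Nint : Nint `<=` N.
Proof. by move=> p [p1 p2]; split; exact: ltW. Qed.

Let f_cvg q : N q -> f z @[z --> within N (nbhs q)] --> f q.
Proof. exact: C1_on_cvg_within. Qed.

Let f_diff q : Nint q -> differentiable f q.
Proof.
move=> qN; apply: C1_on_differentiable f_C1 _.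
by apply: filterS sub_Nint _; exact: open_nbhs_nbhs.
Qed.

(** The cone condition against the fixed point [0]. *)
Lemma quadQ_h_iter_ge n p : (forall k, (k < n)%N -> N (iter k f p)) ->
  m_h ^+ n * quadQ alpha_h 1 p <= quadQ alpha_h 1 (iter n f p).
Proof.
move=> pN; have := @cone_conditions_iter _ _ _ N f alpha_h 1 m_h n p 0.
rewrite iter_f0 !subr0; apply=> //; first by case/andP: m_h_bounds => /ltW.
by move=> k _; rewrite iter_f0.
Qed.

(** Once [Q_v] is positive on a point of the orbit it stays positive up to
time [n], by the cone condition against the fixed point [0]. *)
Lemma quadQ_v_le0_backward n p : (forall k, (k < n)%N -> N (iter k f p)) ->
  quadQ 1 alpha_v (iter n f p) <= 0 ->
  forall k, (k <= n)%N -> quadQ 1 alpha_v (iter k f p) <= 0.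
Proof.
move=> pN Qn k kn; rewrite leNgt; apply/negP => Qk.
have := @cone_conditions_iter _ _ _ N f 1 alpha_v m_v (n - k) (iter k f p) 0.
rewrite iter_f0 !subr0 -iterD subnK// => /(_ (ltW m_v_gt0) cone_v) le_Q.
suff : 0 < quadQ 1 alpha_v (iter n f p) by rewrite ltNge Qn.
apply: lt_le_trans (le_Q _ _).
- by rewrite mulr_gt0// exprn_gt0.
- by move=> j jn; rewrite -iterD; apply: pN; rewrite addnC -ltn_subRL.
- by move=> j _; rewrite iter_f0.
Qed.

(** From [Q_v <= 0] one gets [`|x_k|^2 <= alpha_v < 1].  From the growth of
[Q_h] and [`|y|^2 <= 1 - alpha_h] one gets
[`|y_k|^2 <= alpha_h * `|x_k|^2 + (1 - alpha_h)], which is then less than [1]: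
this is what the radius [r_s] is for. *)
Lemma orbit_interior n p : enorm p.2 <= r_s ->
  (forall k, (k <= n)%N -> N (iter k f p)) ->
  (forall k, (k <= n)%N -> quadQ 1 alpha_v (iter k f p) <= 0) ->
  forall k, (k <= n)%N -> Nint (iter k f p).
Proof.
move=> p2 pN pQ k kn.
have [/andP[ah0 ah1] /andP[av0 av1]] := (alpha_h_bounds, alpha_v_bounds).
have [/andP[mh0 mh1] [Nk1 Nk2]] := (m_h_bounds, pN k kn).
have Qh : m_h ^+ k * quadQ alpha_h 1 p <= quadQ alpha_h 1 (iter k f p).
  by apply: quadQ_h_iter_ge => j jk; apply: pN; rewrite ltnW// (leq_trans jk).
have Qv := pQ k kn.
have p2_sqr : enorm p.2 ^+ 2 <= 1 - alpha_h.
  rewrite -(@sqr_sqrtr _ (1 - alpha_h)) ?subr_ge0 ?(ltW ah1)//.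
  by rewrite ler_pXn2r ?nnegrE ?enorm_ge0 ?sqrtr_ge0.
have mk : 0 <= m_h ^+ k <= 1 by rewrite exprn_ge0 ?exprn_ile1 ?ltW.
have Qp : - (1 - alpha_h) <= m_h ^+ k * quadQ alpha_h 1 p.
  have h : - (1 - alpha_h) <= quadQ alpha_h 1 p.
    have : 0 <= alpha_h * enorm p.1 ^+ 2 by rewrite mulr_ge0 ?sqr_ge0// ltW.
    by rewrite /quadQ; lra.
  by case/andP: mk => mk0 mk1; nra.
rewrite /ecball/= subr0 in Nk1; rewrite /ecball/= subr0 in Nk2.
have y1 : enorm (iter k f p).2 ^+ 2 <= 1 by rewrite expr_le1// enorm_ge0.
rewrite /quadQ !mul1r in Qv; rewrite {2}/quadQ mul1r in Qh.
have y_ge0 := sqr_ge0 (enorm (iter k f p).2).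
have x1 : enorm (iter k f p).1 ^+ 2 < 1 by nra.
have y_lt1 : enorm (iter k f p).2 ^+ 2 < 1 by nra.
rewrite expr_lt1 ?enorm_ge0// in x1; rewrite expr_lt1 ?enorm_ge0// in y_lt1.
by split; rewrite /eball/= subr0.
Qed.

(** A difference of two points with the same [y] has
[Q_h = alpha_h * `|x1 - x2|^2], and [Q_h] of the difference of the images is at
most [alpha_h] times the squared norm of its first component. *)
Lemma fst_iter_expanding n (x1 x2 : 'rV[R]_u) (y : 'rV[R]_s) :
  (forall k, (k < n)%N -> N (iter k f (x1, y))) ->
  (forall k, (k < n)%N -> N (iter k f (x2, y))) ->
  Num.sqrt m_h ^+ n * enorm (x1 - x2) <=
    enorm ((iter n f (x1, y)).1 - (iter n f (x2, y)).1).
Proof.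
move=> N1 N2; have [/andP[ah0 _] /andP[mh0 _]] := (alpha_h_bounds, m_h_bounds).
have := cone_conditions_iter (ltW mh0) cone_h N1 N2.
rewrite {1}/quadQ /= subrr enorm0 expr0n mulr0 subr0 => le_Q.
rewrite -(@ler_pXn2r _ 2)// ?nnegrE ?enorm_ge0 ?mulr_ge0 ?exprn_ge0 ?sqrtr_ge0 ?enorm_ge0//.
rewrite exprMn -exprM mulnC exprM sqr_sqrtr ?(ltW mh0)// -(ler_pM2l ah0) mulrCA.
by apply: le_trans le_Q _; rewrite /quadQ mul1r gerBl sqr_ge0.
Qed.

(** The equation [(iter n f p).1 = 0] has as many unknowns as equations once
[p.2] is fixed, and it forces [Q_v <= 0] along the orbit. *)
Definition returns_to_axis n : set ('rV[R]_u * 'rV[R]_s) :=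
  [set p | (forall k, (k <= n)%N -> N (iter k f p)) /\ (iter n f p).1 = 0].

Lemma closed_returns_to_axis n : closed (returns_to_axis n).
Proof.
apply: (@closed_orbits _ N [set q | q.1 = 0] f n closed_N _ f_cvg).
have /continuous_closedP h : continuous (@fst 'rV[R]_u 'rV[R]_s).
  by move=> q; exact: cvg_fst.
have cl0 : closed [set (0 : 'rV[R]_u)].
  exact/accessible_closed_set1/hausdorff_accessible/norm_hausdorff.
exact: h _ cl0.
Qed.

Lemma returns_to_axis_cone n p : returns_to_axis n p ->
  forall k, (k <= n)%N -> quadQ 1 alpha_v (iter k f p) <= 0.
Proof.
move=> [pN pn]; apply: quadQ_v_le0_backward => [k kn|]; first exact/pN/ltnW.
rewrite /quadQ pn enorm0 expr0n mulr0 sub0r oppr_le0 mulr_ge0 ?sqr_ge0//.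
by case/andP: alpha_v_bounds => /ltW.
Qed.

(** The orbit of a solution lies in the interior of [N] and hence so do the
orbits of nearby points; there [expanding_zero] solves the equation for every
[y] close to [y0], because [(iter n f (x0, y)).1] is still small. *)
Lemma returns_to_axis_open n x0 y0 : enorm y0 <= r_s ->
  returns_to_axis n (x0, y0) ->
  \forall y \near y0, exists x, returns_to_axis n (x, y).
Proof.
move=> y0r p0n; have [p0N p0axis] := p0n.
have mh0 : 0 < m_h by case/andP: m_h_bounds.
have p0int : forall k, (k <= n)%N -> Nint (iter k f (x0, y0)).
  by apply: orbit_interior => //; exact: returns_to_axis_cone.
have [[A B] /= [xA yB] AB] := near_orbit open_Nint f_diff p0int.
have [e e0 eA] := nbhs_ecball xA.
have c0 : 0 < Num.sqrt m_h ^+ n by rewrite exprn_gt0 ?sqrtr_gt0.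
have fn_cont : {for (x0, y0), continuous (iter n f)}.
  apply/differentiable_continuous/(differentiable_iter f_diff) => k kn.
  exact/p0int/ltnW.
have small : \forall y \near y0,
    enorm (iter n f (x0, y)).1 < Num.sqrt m_h ^+ n * e / 2.
  have lim : enorm (iter n f (x0, y)).1 @[y --> y0] --> enorm (iter n f (x0, y0)).1.
    have y_lim : (x0, y) @[y --> y0] --> (x0, y0).
      exact: (@cvg_pair _ 'rV[R]_u 'rV[R]_s (nbhs y0) (nbhs x0) (nbhs y0)
        _ _ _ (fun=> x0) id (cvg_cst x0) cvg_id).
    have fst_cont : {for iter n f (x0, y0), continuous fst} by exact: cvg_fst.
    have fn_lim := cvg_comp _ _ (cvg_comp _ _ y_lim fn_cont) fst_cont.
    exact: (continuous_cvg _ (@enorm_continuous R u _) fn_lim).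
  apply: (cvgr_lt _ lim); rewrite p0axis enorm0.
  by rewrite divr_gt0 ?mulr_gt0.
near=> y.
have By : B y by near: y.
have W x : ecball x0 e x -> forall k, (k <= n)%N -> Nint (iter k f (x, y)).
  by move=> /eA Ax; apply: AB.
have [|x1 x2 B1 B2|x xB||x xB Fx] :=
  @expanding_zero R u (fun x => (iter n f (x, y)).1) x0 e (Num.sqrt m_h ^+ n) c0.
- exact: e0.
- by apply: fst_iter_expanding => k kn; apply: sub_Nint;
    [exact: (W _ B1 _ (ltnW kn))|exact: (W _ B2 _ (ltnW kn))].
- apply: (@differentiable_comp _ _ _ _ (fun x => iter n f (x, y)) fst).
    apply: (@differentiable_comp _ _ _ _ (fun x => (x, y)) (iter n f)).
      by apply: differentiable_pair; [exact: ex_diff|exact: differentiable_cst].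
    by apply: (differentiable_iter f_diff) => k kn; exact: (W _ xB _ (ltnW kn)).
  by apply: linear_differentiable => q; exact: cvg_fst.
- by near: y.
- by exists x; split=> // k kn; exact/sub_Nint/W.
Unshelve. all: by end_near. Qed.

(** Continuation along [t *: y], [0 <= t <= 1], from the solution [0] at
[t = 0].  The solutions form a compact set, so there is one with [t] maximal,
and [returns_to_axis_open] would extend it further if [t < 1]. *)
Lemma returns_to_axis_exists n (y : 'rV[R]_s) :
  enorm y <= r_s -> exists x, returns_to_axis n (x, y).
Proof.
move=> yr; pose g (z : 'rV[R]_u * R) := (z.1, z.2 *: y).
pose P := (ecball (0 : 'rV[R]_u) 1 `*` `[0, 1]%classic) `&` g @^-1` (returns_to_axis n).
have g_cont : continuous g.
  move=> z; apply: (@cvg_pair _ 'rV[R]_u 'rV[R]_s (nbhs z) (nbhs z.1)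
    (nbhs (z.2 *: y)) _ _ _ fst (fun q => q.2 *: y)); first exact: cvg_fst.
  by apply: cvgZr_tmp; exact: cvg_snd.
have compactX : compact (ecball (0 : 'rV[R]_u) 1 `*` `[0 : R, 1]%classic).
  by apply: compact_setX; [exact: compact_ecball|exact: segment_compact].
have Pcompact : compact P.
  apply: subclosed_compact compactX _; last by move=> z [].
  apply: closedI; first by apply: closed_setX; [exact: closed_ecball|exact: itv_closed].
  by have /continuous_closedP gP := g_cont; exact: gP _ (@closed_returns_to_axis n).
have P0 : P !=set0.
  exists (0, 0); split; first by case: N0 => N01 _; split=> //=; rewrite in_itv/= lexx ler01.
  rewrite /g /= scale0r; split=> [k _|]; last by rewrite iter_f0.
  by rewrite iter_f0.
have snd_cont : {within P, continuous (@snd 'rV[R]_u R)}.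
  by apply: continuous_subspaceT => z; exact: cvg_snd.
have [[x0 t0] /set_mem[[_ /= t01] xt0] tmax] := compact_EVT_max P0 Pcompact snd_cont.
move: t01; rewrite in_itv/= => /andP[t0_ge0]; rewrite le_eqVlt => /orP[/eqP t0E|t0_lt1].
  by exists x0; move: xt0; rewrite /g /= t0E scale1r.
have y0r : enorm (t0 *: y) <= r_s.
  rewrite enormZ ger0_norm//; apply: le_trans yr.
  by rewrite ler_piMl ?enorm_ge0// ltW.
have t_lim : t *: y @[t --> t0] --> t0 *: y by apply: cvgZr_tmp; exact: cvg_id.
have open_t : \forall t \near t0, exists x, returns_to_axis n (x, t *: y).
  exact: t_lim _ (returns_to_axis_open y0r xt0).
have [t [[x xt] t_gt t_lt]] : exists t,
    [/\ exists x, returns_to_axis n (x, t *: y), t0 < t & t < 1].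
  apply: (@filter_ex _ t0^'+); near=> t; split.
  - by near: t; exact: (cvg_within _ open_t).
  - by near: t; exact: nbhs_right_gt.
  - by near: t; exact: nbhs_right_lt.
have /negP[] : ~~ ((x, t) \in P).
  by apply/negP => /tmax; rewrite /= leNgt t_gt.
apply/mem_set; split=> //.
split=> /=; first by case: xt => /(_ 0%N (leq0n _)) [].
by rewrite in_itv/= (le_trans t0_ge0 (ltW t_gt)) ltW.
Unshelve. all: by end_near. Qed.

(** A cluster point of the solutions [x_ n] for the times [n] meets the closed
constraints for every time. *)
Lemma forward_cone_orbit_exists (y : 'rV[R]_s) : enorm y <= r_s ->
  exists x, forall n,
    N (iter n f (x, y)) /\ quadQ 1 alpha_v (iter n f (x, y)) <= 0.
Proof.
move=> yr; have /choice[x_ xP] n := @returns_to_axis_exists n y yr.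
pose K n := [set p | (forall k, (k <= n)%N -> N (iter k f p)) /\
  [set q | quadQ 1 alpha_v q <= 0] (iter n f p)].
have closed_cone : closed [set q : 'rV[R]_u * 'rV[R]_s | quadQ 1 alpha_v q <= 0].
  have Q_cont : continuous (quadQ 1 alpha_v : 'rV[R]_u * 'rV[R]_s -> R).
    move=> q.
    have c1 : {for q, continuous (fun q : 'rV[R]_u * 'rV[R]_s => enorm q.1)}.
      apply: (@continuous_comp _ _ _ fst (@enorm R u)); first exact: cvg_fst.
      exact: enorm_continuous.
    have c2 : {for q, continuous (fun q : 'rV[R]_u * 'rV[R]_s => enorm q.2)}.
      apply: (@continuous_comp _ _ _ snd (@enorm R s)); first exact: cvg_snd.
      exact: enorm_continuous.
    apply: cvgB; apply: cvgM; try exact: cvg_cst; exact: cvgM.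
  by have /continuous_closedP QP := Q_cont; exact: QP _ (@closed_le _ 0).
have closed_K n : closed (K n) by exact: closed_orbits.
have xK n m : (n <= m)%N -> K n (x_ m, y).
  move=> nm; split=> [k kn|]; first by apply: (xP m).1; exact: leq_trans nm.
  exact: returns_to_axis_cone (xP m) _ nm.
have xB : \forall n \near \oo, ecball 0 1 (x_ n).
  by apply: nearW => n; have [/(_ 0%N (leq0n _)) []] := xP n.
have [x [_ xcl]] := @compact_ecball R u 0 1 (x_ @ \oo) _ xB.
exists x => n; suff [xN xQ] : K n (x, y) by split=> //; exact: xN.
apply: closed_K => B [[B1 B2] /= [xB1 yB2] B12].
have [|z [Kz B1z]] := xcl [set z | K n (z, y)] B1 _ xB1.
  by exists n => // m /= nm; exact: xK.
by exists (z, y); split=> //; apply: B12; split=> //=; exact: nbhs_singleton.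
Qed.

(** [Q_v <= 0] gives [`|x|^2 <= alpha_v * `|y|^2], so that
[(1 - alpha_h * alpha_v) * `|y|^2 <= - Q_h] and [`|x|^2 + `|y|^2 <= 2 * `|y|^2].
Since [- Q_h] is at most [m_h ^+ n] at time [n], the constant
[2 / (1 - alpha_h * alpha_v)] bounds the squares. *)
Lemma forward_cone_strong_stable p :
  (forall n, N (iter n f p) /\ quadQ 1 alpha_v (iter n f p) <= 0) ->
  strong_stable f (Num.sqrt m_h) N p.
Proof.
move=> pNQ; have pN n := (pNQ n).1; have pQ n := (pNQ n).2.
have [/andP[ah0 ah1] /andP[av0 av1]] := (alpha_h_bounds, alpha_v_bounds).
have mh0 : 0 < m_h by case/andP: m_h_bounds.
have d0 : 0 < 1 - alpha_h * alpha_v by rewrite subr_gt0; nra.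
split; first exact: (pN 0%N).
split=> //; exists (Num.sqrt (2 / (1 - alpha_h * alpha_v))) => [|n].
  by rewrite sqrtr_gt0 divr_gt0.
have mn0 : 0 < m_h ^+ n by rewrite exprn_gt0.
have -> : Num.sqrt m_h ^+ n = Num.sqrt (m_h ^+ n).
  rewrite -[LHS]gtr0_norm ?exprn_gt0 ?sqrtr_gt0// -sqrtr_sqr -exprM mulnC exprM.
  by rewrite sqr_sqrtr// ltW.
rewrite -sqrtrM ?divr_ge0 ?(ltW d0)// /enorm2 ler_wsqrtr//.
rewrite mulrAC ler_pdivlMr//.
have Qh := quadQ_h_iter_ge (fun k _ => pN k) : m_h ^+ n * _ <= quadQ _ _ (iter n f p).
have Qv := pQ n; rewrite /quadQ !mul1r in Qv; rewrite {2}/quadQ mul1r in Qh.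
have Qp : - m_h ^+ n <= m_h ^+ n * quadQ alpha_h 1 p.
  rewrite -mulrN1 ler_pM2l// /quadQ mul1r.
  have [_] := pN 0%N; rewrite /ecball/= subr0 => y1.
  have {}y1 : enorm p.2 ^+ 2 <= 1 by rewrite expr_le1// enorm_ge0.
  have : 0 <= alpha_h * enorm p.1 ^+ 2 by rewrite mulr_ge0 ?sqr_ge0// ltW.
  by lra.
have X0 := sqr_ge0 (enorm (iter n f p).1).
have Y0 := sqr_ge0 (enorm (iter n f p).2).
move: (enorm (iter n f p).1 ^+ 2) (enorm (iter n f p).2 ^+ 2) Qv Qh X0 Y0 => X Y.
move=> Qv Qh X0 Y0.
have XY : X <= Y by nra.
have : (1 - alpha_h * alpha_v) * Y <= m_h ^+ n by nra.
by nra.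
Qed.

End StableFibres.

(** * The stable manifold *)

Theorem theorem8 (R : realType) (u s : nat)
    (f : 'rV[R]_u * 'rV[R]_s -> 'rV[R]_u * 'rV[R]_s)
    (alpha_h alpha_v m_h m_v : R) :
  let N := ecball (0 : 'rV[R]_u) 1 `*` ecball (0 : 'rV[R]_s) 1 in
  let r_s := Num.sqrt (1 - alpha_h) in
  let U := ecball (0 : 'rV[R]_u) 1 `*` ecball (0 : 'rV[R]_s) r_s in
  C1_on N f ->
  f 0 = 0 ->
  0 < alpha_h < 1 ->
  0 < alpha_v < 1 ->
  0 < m_h -> m_h < m_v -> m_h < 1 ->
  cone_conditions N f (quadQ alpha_h 1) m_h ->
  cone_conditions N f (quadQ 1 alpha_v) m_v ->
  exists w : 'rV[R]_s -> 'rV[R]_u,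
    [/\ forall y, ecball 0 r_s y -> eball 0 1 (w y),
        strong_stable f (Num.sqrt m_h) N `&` U =
          [set (w y, y) | y in ecball 0 r_s]
      & forall y1 y2, ecball 0 r_s y1 -> ecball 0 r_s y2 ->
          enorm (w y1 - w y2) <= Num.sqrt alpha_v * enorm (y1 - y2)].
Proof.
move=> N r_s U fC1 f00 ah av mh0 mhv mh1 coneh conev.
have [/andP[ah0 ah1] /andP[av0 av1]] := (ah, av).
have mh : 0 < m_h < 1 by rewrite mh0.
have mv0 : 0 < m_v by exact: lt_trans mhv.
have /choice[w wP] y : exists x, ecball 0 r_s y -> forall n,
    N (iter n f (x, y)) /\ quadQ 1 alpha_v (iter n f (x, y)) <= 0.
  have [yr|yr] := pselect (ecball 0 r_s y); last by exists 0.
  have [|x xP] := forward_cone_orbit_exists fC1 f00 ah av mh mv0 coneh conev (y := y).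
    by move: yr; rewrite /ecball/= subr0.
  by exists x => _; exact: xP.
have wS y : ecball 0 r_s y -> strong_stable f (Num.sqrt m_h) N (w y, y).
  move=> yr; apply: (forward_cone_strong_stable f00 ah av mh coneh); exact: wP.
have cone_lt p1 p2 : strong_stable f (Num.sqrt m_h) N p1 ->
    strong_stable f (Num.sqrt m_h) N p2 -> p1 <> p2 ->
    quadQ 1 alpha_v (p1 - p2) < 0.
  by apply: quadQ_strong_stable_lt0 conev; rewrite ?mh0.
exists w; split=> [y yr||y1 y2 y1r y2r].
- have [[_ Ny] Q] := wP y yr 0%N; rewrite /eball/= subr0 -(@expr_lt1 _ 2)// ?enorm_ge0//.
  rewrite /ecball/= subr0 in Ny.
  have {}Ny : enorm y ^+ 2 <= 1 by rewrite expr_le1// enorm_ge0.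
  by rewrite /quadQ/= !mul1r in Q; nra.
- apply/seteqP; split=> [[x y] [Sxy [_ /= yr]]|_ [y yr <-]]; last first.
    split; first exact: wS.
    by split=> //=; have [[]] := wP y yr 0%N.
  exists y => //; apply: contrapT => /(cone_lt _ _ (wS y yr) Sxy).
  by rewrite /quadQ/= subrr enorm0 expr0n mulr0 subr0 mul1r ltNge sqr_ge0.
- have [->|/eqP y12] := eqVneq y1 y2; first by rewrite !subrr !enorm0 mulr0.
  have /(cone_lt _ _ (wS _ y1r) (wS _ y2r)) : (w y1, y1) <> (w y2, y2) by case.
  rewrite /quadQ/= mul1r subr_lt0 => /ltW Q.
  rewrite -(@ler_pXn2r _ 2)// ?nnegrE ?enorm_ge0 ?mulr_ge0 ?sqrtr_ge0 ?enorm_ge0//.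
  by rewrite exprMn (sqr_sqrtr (ltW av0)).
Qed.
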